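(* Let $j$ be any positive integer and let $\mathbf{I}\mathbb{N}_{\infty}^{\boldsymbol{g}[j]}$ be a proper dense subsemigroup of a Hausdorff semitopological semigroup $S$. Then $I=S\setminus \mathbf{I}\mathbb{N}_{\infty}^{\boldsymbol{g}[j]}$ is a closed ideal of $S$.
   Context: $\mathbb{N}$ is the set of positive integers with the metric $|n-m|$ and $[n)=\{m\in\mathbb{N}\colon m\geqslant n\}$. Partial maps are written on the right and composed left to right: $x(\gamma\delta)=(x\gamma)\delta$, with $\operatorname{dom}(\gamma\delta)=\{x\in\operatorname{dom}\gamma\colon x\gamma\in\operatorname{dom}\delta\}$. $\mathbf{I}\mathbb{N}_{\infty}$ is the inverse monoid (under composition) of all partial isometries $\gamma\colon\mathbb{N}\rightharpoonup\mathbb{N}$ (i.e. $|x\gamma-y\gamma|=|x-y|$ for all $x,y\in\operatorname{dom}\gamma$) which are cofinite, i.e. $\mathbb{N}\setminus\operatorname{dom}\gamma$ and $\mathbb{N}\setminus\operatorname{ran}\gamma$ are finite. $\mathscr{C}_{\mathbb{N}}$ is its submonoid generated by $\alpha\colon n\mapsto n+1$ ($\operatorname{dom}\alpha=\mathbb{N}$) and $\beta\colon n\mapsto n-1$ ($\operatorname{dom}\beta=\mathbb{N}\setminus\{1\}$); it is isomorphic to the bicyclic monoid. For $\gamma\in\mathbf{I}\mathbb{N}_{\infty}$, $\underline{n}_{\gamma}^{\mathbf{d}}=\min\operatorname{dom}\gamma$, and $n_{\gamma}^{\mathbf{d}}$ is the smallest $n\in\operatorname{dom}\gamma$ such that the restriction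 $\gamma|_{[n)}$ belongs to $\mathscr{C}_{\mathbb{N}}$ (i.e. $[n)\subseteq\operatorname{dom}\gamma$ and $\gamma$ is a shift on $[n)$). For a non-negative integer $j$, $\mathbf{I}\mathbb{N}_{\infty}^{\boldsymbol{g}[j]}=\{\gamma\in\mathbf{I}\mathbb{N}_{\infty}\colon n_{\gamma}^{\mathbf{d}}-\underline{n}_{\gamma}^{\mathbf{d}}\leqslant j\}$, which is an inverse submonoid of $\mathbf{I}\mathbb{N}_{\infty}$. A semitopological semigroup is a topological space with a separately continuous semigroup operation. *)

(* Defs.v *)
From HB Require Import structures.
From mathcomp Require Import all_boot all_order all_algebra.
From mathcomp Require Import all_classical all_reals all_analysis.
From mathcomp Require Import zify.

Set Implicit Arguments.
Unset Strict Implicit.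
Unset Printing Implicit Defensive.

Import Order.TTheory GRing.Theory Num.Theory.

Local Open Scope classical_set_scope.

Notation posnat := {n : nat | (0 < n)%N}.

Definition partial_map := posnat -> option posnat.

HB.instance Definition _ := Choice.copy partial_map (posnat -> option posnat).

Definition dom (g : partial_map) : set posnat := [set x | isSome (g x)].

Definition ran (g : partial_map) : set posnat :=
  [set y | exists x, g x = Some y].

(* Maps act on the right: [x (pcompose g h) = (x g) h]. *)
Definition pcompose (g h : partial_map) : partial_map := pcomp h g.

Definition pid : partial_map := Some.

(* [insub k] is [Some k] when [0 < k] and [None] when [k = 0], so that [beta]
   is undefined exactly at 1. *)
Definition alpha : partial_map := fun n => insub (val n).+1.

Definition beta : partial_map := fun n => insub (val n).-1.

Inductive C_N : set partial_map :=
| C_N_id : C_N pid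
| C_N_alpha : C_N alpha
| C_N_beta : C_N beta
| C_N_compose g h : C_N g -> C_N h -> C_N (pcompose g h).

Definition partial_isometry (g : partial_map) : Prop :=
  forall x y x' y' : posnat, g x = Some x' -> g y = Some y' ->
    (`|(val x')%:Z - (val y')%:Z| = `|(val x)%:Z - (val y)%:Z|)%R.

Definition cofinite_map (g : partial_map) : Prop :=
  finite_set (~` dom g) /\ finite_set (~` ran g).

Definition IN_infty : set partial_map :=
  [set g | partial_isometry g /\ cofinite_map g].

Definition restrict_from (n : posnat) (g : partial_map) : partial_map :=
  fun x => if (val n <= val x)%N then g x else None.

(* The default value 1 is only taken when [A] is empty. *)
Definition minimum (A : set posnat) : posnat :=
  xget (exist _ 1%N isT) [set n | A n /\ forall m, A m -> (val n <= val m)%N].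

Definition min_dom (g : partial_map) : posnat := minimum (dom g).

Definition min_shift (g : partial_map) : posnat :=
  minimum [set n | dom g n /\ C_N (restrict_from n g)].

(* Subtraction is truncated, which is harmless: [min_dom g <= min_shift g] for
   every [g] in [IN_infty]. *)
Definition IN_g_set (j : nat) : set partial_map :=
  [set g | IN_infty g /\ (val (min_shift g) - val (min_dom g) <= j)%N].

(* Puts the projections of [posnat] in a common form before calling [lia]. *)
Ltac plia := intros; simpl in *; lia.

Lemma minimumP (A : set posnat) : A !=set0 ->
  A (minimum A) /\ forall m, A m -> (val (minimum A) <= val m)%N.
Proof.
move=> [a Aa]; rewrite /minimum.
case: xgetP => [//|/= noP]; exfalso.
have ex : exists n : nat, `[< exists2 x, A x & val x = n >].
  by exists (val a); apply/asboolP; exists a.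
have [n /asboolP[x Ax xn] nmin] := ex_minnP ex.
apply: (noP x); split => // m Am.
by rewrite xn; apply: nmin; apply/asboolP; exists m.
Qed.

Lemma cofiniteP (A : set posnat) :
  finite_set (~` A) <-> exists N : nat, forall x, (N < val x)%N -> A x.
Proof.
split.
- case/finite_seqP => s sE; exists (\max_(x <- s) val x)%N => x xN.
  apply: contrapT => nAx.
  have : [set` s] x by rewrite -sE.
  move=> /= xs; have := @leq_bigmax_seq _ s xpredT (fun x => val x) x xs isT.
  by rewrite leqNgt xN.
- move=> [N AN].
  apply: (@sub_finite_set _ _ (val @^-1` `I_N.+1)).
    by move=> x nAx /=; rewrite ltnS leqNgt; apply/negP => /AN.
  apply: finite_preimage; last exact: finite_II.
  by move=> x y _ _; exact: val_inj.
Qed.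

Lemma isometry_translation (g : partial_map) : IN_infty g ->
  exists a b : nat, forall x y, g x = Some y -> (val x + a = val y + b)%N.
Proof.
move=> [iso [/cofiniteP[N domN] _]].
pose s (k : nat) : posnat := exist (fun n => (0 < n)%N) k.+1 isT.
have gs k : (N <= k)%N -> exists y, g (s k) = Some y.
  move=> Nk; have : dom g (s k) by apply: domN; rewrite /= ltnS.
  by rewrite /dom /=; case: (g (s k)) => // y _; exists y.
have [p gp] := gs N (leqnn N).
exists (val p), N.+1 => x y gx.
have [q gq] := gs (N + val p + val x + val y).+1%N ltac:(plia).
have := iso _ _ _ _ gp gq.
have := iso _ _ _ _ gx gq.
by rewrite /=; case: (p) (q) (x) (y) => [p' ?] [q' ?] [x' ?] [y' ?] /=; plia.
Qed.

Lemma IN_inftyM (g h : partial_map) :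
  IN_infty g -> IN_infty h -> IN_infty (pcompose g h).
Proof.
move=> Ig Ih.
have [a [b gab]] := isometry_translation Ig.
have [c [d hcd]] := isometry_translation Ih.
case: Ig => isog [/cofiniteP[N1 dg] /cofiniteP[N2 rg]].
case: Ih => isoh [/cofiniteP[N3 dh] /cofiniteP[N4 rh]].
split; last split.
- move=> x y x' y'; rewrite /pcompose /pcomp /=.
  case gx: (g x) => [u|//]; case gy: (g y) => [v|//] /= hu hv.
  by rewrite (isoh _ _ _ _ hu hv) (isog _ _ _ _ gx gy).
- apply/cofiniteP; exists (N1 + N3 + b)%N => x xN.
  have := dg x ltac:(plia); rewrite /dom /pcompose /pcomp /=.
  case gx: (g x) => [u|//] _ /=; apply: dh.
  by have := gab _ _ gx; plia.
- apply/cofiniteP; exists (N2 + N4 + c)%N => y yN.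
  have [u hu] := rh y ltac:(plia).
  have := hcd _ _ hu => E.
  have [x gx] := rg u ltac:(plia).
  by exists x; rewrite /pcompose /pcomp /= gx.
Qed.

Lemma C_N_shift (g : partial_map) : C_N g ->
  exists i k : nat, forall x y,
    g x = Some y <-> (i < val x)%N /\ (val x + k = val y + i)%N.
Proof.
elim=> [|||{}g h _ [i [k gE]] _ [l [m hE]]].
- exists 0%N, 0%N => x y; split=> [[<-]|[_ E]].
    by case: x => x' hx; split.
  by congr Some; apply: val_inj; move: E; rewrite !addn0.
- exists 0%N, 1%N => x y; rewrite /alpha; case: insubP => [u _ uE|//].
  split=> [[<-]|[_ E]]; first by case: x uE => x' hx /= ->; split; plia.
  by congr Some; apply: val_inj; rewrite uE; plia.
- exists 1%N, 0%N => x y; rewrite /beta; case: insubP => [u h uE|h].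
    split=> [[<-]|[_ E]]; first by split; plia.
    by congr Some; apply: val_inj; rewrite uE; plia.
  by split => // -[]; plia.
- exists (i + (l - k))%N, (m + (k - l))%N => x y; rewrite /pcompose /pcomp /=.
  split.
    case gx: (g x) => [u|//] /= hu.
    by have := (gE _ _).1 gx; have := (hE _ _).1 hu; rewrite /=; plia.
  move=> [ix E].
  have up : (0 < val x + k - i)%N by plia.
  have /gE -> /= : (i < val x)%N /\
    (val x + k = val (exist (fun n => (0 < n)%N) _ up : posnat) + i)%N.
    by rewrite /=; plia.
  by apply/hE => /=; plia.
Qed.

Lemma shift_C_N (g : partial_map) (i k : nat) :
  (forall x y, g x = Some y <-> (i < val x)%N /\ (val x + k = val y + i)%N) ->
  C_N g.
Proof.
elim: i k g => [|i IHi] k g.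
  elim: k g => [|k IHk] g gE.
    suff -> : g = pid by exact: C_N_id.
    by apply/funext => x; apply/gE; split; [exact: valP|].
  pose f : partial_map := fun x => insub (val x + k)%N.
  have fE x y : f x = Some y <-> (0 < val x)%N /\ (val x + k = val y + 0)%N.
    rewrite /f; have x0 : (0 < val x)%N := valP x.
    case: insubP => [u _ uE|]; last by plia.
    split=> [[<-]|[_ E]]; first by plia.
    by congr Some; apply: val_inj; rewrite uE; plia.
  suff -> : g = pcompose f alpha.
    by apply: C_N_compose; [exact: IHk fE|exact: C_N_alpha].
  apply/funext => x; have x0 : (0 < val x)%N := valP x.
  rewrite /pcompose /pcomp /= /f; case: insubP => [u _ uE|]; last by plia.
  rewrite /= /alpha; case: insubP => [v _ vE|//].
  by apply/gE; plia.
move=> gE.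
pose f : partial_map := fun x =>
  if (i < val x)%N then insub (val x + k - i)%N else None.
have fE x y : f x = Some y <-> (i < val x)%N /\ (val x + k = val y + i)%N.
  rewrite /f; case: ifP => [ix|ix]; last by split=> // -[]; plia.
  case: insubP => [u _ uE|]; last by plia.
  split=> [[<-]|[_ E]]; first by plia.
  by congr Some; apply: val_inj; rewrite uE; plia.
suff -> : g = pcompose beta f.
  by apply: C_N_compose; [exact: C_N_beta|exact: IHi fE].
apply/funext => x; have x0 : (0 < val x)%N := valP x.
have gN : ~~ (i.+1 < val x)%N -> g x = None.
  by case gx: (g x) => [y|//]; move/gE: gx; plia.
rewrite /pcompose /pcomp /= /beta; case: insubP => [u _ uE|h] /=; last first.
  by apply: gN; plia.
rewrite /f; case: ifP => iu; last by apply: gN; plia.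
by case: insubP => [v _ vE|]; [apply/gE; plia|plia].
Qed.

Lemma restrict_C_N (g : partial_map) (n : posnat) : IN_infty g -> dom g n ->
  C_N (restrict_from n g) <-> forall x, (val n <= val x)%N -> dom g x.
Proof.
move=> Ig; rewrite {1}/dom /=; case gn: (g n) => [p|//] _.
have [a [b gab]] := isometry_translation Ig.
have p0 : (0 < val p)%N := valP p.
have n0 : (0 < val n)%N := valP n.
split.
- case/C_N_shift => i [k E] x nx.
  have /E[iN _] : restrict_from n g n = Some p by rewrite /restrict_from leqnn.
  have x0 : (0 < val x + k - i)%N by plia.
  have : restrict_from n g x = Some (exist (fun n => (0 < n)%N) _ x0 : posnat).
    by apply/E => /=; plia.
  by rewrite /restrict_from nx /dom /= => ->.
- move=> dn; apply: (@shift_C_N _ (val n).-1 (val p).-1) => x y.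
  have := gab _ _ gn; rewrite /restrict_from => gnE.
  case: ifP => nx; last by split=> // -[]; plia.
  have := dn x nx; rewrite /dom /=; case gx: (g x) => [z|//] _.
  have := gab _ _ gx => gxE.
  split=> [[<-]|[_ E]]; first by plia.
  by congr Some; apply: val_inj; plia.
Qed.

Lemma IN_infty_dom (g : partial_map) : IN_infty g -> dom g !=set0.
Proof.
move=> [_ [/cofiniteP[N dg] _]].
by exists (exist (fun n => (0 < n)%N) N.+1 isT); apply: dg.
Qed.

Lemma IN_infty_shift (g : partial_map) : IN_infty g ->
  [set n | dom g n /\ C_N (restrict_from n g)] !=set0.
Proof.
move=> Ig; have [_ [/cofiniteP[N dg] _]] := Ig.
exists (exist (fun n => (0 < n)%N) N.+1 isT).
have dN := dg (exist (fun n => (0 < n)%N) N.+1 isT) (ltnSn N).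
by split => //; apply/restrict_C_N => // x xN; apply: dg.
Qed.

Lemma IN_g_setM (j : nat) (g h : partial_map) :
  IN_g_set j g -> IN_g_set j h -> IN_g_set j (pcompose g h).
Proof.
move=> [Ig gj] [Ih hj]; have Igh := IN_inftyM Ig Ih; split => //.
move: gj hj; rewrite /min_shift /min_dom.
have [[dng Cng] _] := minimumP (IN_infty_shift Ig).
have [_ mgmin] := minimumP (IN_infty_dom Ig).
have [[dnh Cnh] _] := minimumP (IN_infty_shift Ih).
have [_ mhmin] := minimumP (IN_infty_dom Ih).
have [dmgh _] := minimumP (IN_infty_dom Igh).
have [_ nghmin] := minimumP (IN_infty_shift Igh).
move: dng Cng mgmin dnh Cnh mhmin dmgh nghmin.
move: (minimum (dom g)) (minimum (dom h)) => mg mh.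
move: (minimum (dom _)) => mgh.
move: (minimum _) => ng; move: (minimum _) => nh; move: (minimum _) => ngh.
move=> dng Cng mgmin dnh Cnh mhmin dmgh nghmin gj hj.
move: Cnh Cng => /(restrict_C_N Ih dnh) nhd /(restrict_C_N Ig dng) ngd.
have [a [b gab]] := isometry_translation Ig.
move: dmgh; rewrite /dom /pcompose /pcomp /=.
case gm: (g mgh) => [u|//] /= hu.
have mg_le : (val mg <= val mgh)%N by apply: mgmin; rewrite /dom /= gm.
have mh_le : (val mh <= val u)%N by apply: mhmin.
have gE := gab _ _ gm.
have mgh0 : (0 < val mgh + j)%N by have := valP mgh; rewrite /=; plia.
pose n : posnat := exist (fun n => (0 < n)%N) (val mgh + j)%N mgh0.
suff dn x : (val n <= val x)%N -> dom (pcompose g h) x.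
  have : (val ngh <= val n)%N.
    by apply: nghmin; split; [|apply/restrict_C_N => //]; exact: dn.
  by rewrite /n /=; plia.
rewrite /n /= => nx.
have := ngd x ltac:(plia); rewrite /dom /pcompose /pcomp /=.
case gx: (g x) => [y|//] _ /=.
by apply: nhd; have := gab _ _ gx; plia.
Qed.

Definition IN_g (j : nat) : Type := set_type (IN_g_set j).

HB.instance Definition _ (j : nat) := Choice.on (IN_g j).

Definition IN_g_mul (j : nat) (g h : IN_g j) : IN_g j :=
  SigSub (mem_set (IN_g_setM (set_valP g) (set_valP h))).

Lemma IN_g_mulA (j : nat) : associative (@IN_g_mul j).
Proof.
move=> f g h; apply: val_inj; apply/funext => x /=.
by rewrite /pcompose /pcomp /=; case: (val f x) => //=.
Qed.

HB.instance Definition _ (j : nat) := isSemigroup.Build (IN_g j) (@IN_g_mulA j).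

HB.mixin Record isSemitopological S of Topological S & Semigroup S := {
  mulg_continuousl : forall a : S, continuous (fun x : S => (a * x)%g);
  mulg_continuousr : forall a : S, continuous (fun x : S => (x * a)%g)
}.

#[short(type="semitopologicalSemigroupType")]
HB.structure Definition SemitopologicalSemigroup :=
  {S of Topological S & Semigroup S & isSemitopological S}.

Definition ideal (S : semigroupType) (I : set S) : Prop :=
  I !=set0 /\ forall s x : S, I x -> I (s * x)%g /\ I (x * s)%g.

(* Main.v *)
Require Import Defs.
From HB Require Import structures.
From mathcomp Require Import all_boot all_order all_algebra.
From mathcomp Require Import all_classical all_reals all_analysis.
From mathcomp Require Import zify.

Local Open Scope classical_set_scope.

(** Every point of the dense copy [M] of [IN_g j] is isolated in [S].  The points
    moved by both translations by the idempotent [epsilon = id] on [2, oo) form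
    an open set, and its trace on [M] is finite: such an element has 1 in its
    domain and in its range, hence is the identity on a set containing 1, and
    the bound [j] makes this domain contain [j + 1, oo).  A finite trace on a
    dense set forces an open set to be that trace, so the identity is isolated.
    For every [g] in [M] some translations satisfy [alpha^n g beta^m = 1], and
    the equation [a x b = c] has only finitely many solutions in [M], so [g] is
    isolated as well.  Hence [S \ M] is closed.  If [y g = h] with [g], [h] in
    [M], then [y] lies in the open set of solutions of [x g = h], whose trace on
    [M] is finite, so [y] is in [M]; density extends this to products [y x] with
    [x] in [S]. *)

Section DenseTrace.
Variables (T : topologicalType) (D : set T).
Hypotheses (T_hausdorff : hausdorff_space T) (D_dense : dense D).

Lemma finite_set_closed (A : set T) : finite_set A -> closed A.
Proof.
exact: (accessible_finite_set_closed.1 (hausdorff_accessible T_hausdorff)).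
Qed.

Lemma open_neq (f g : T -> T) :
  continuous f -> continuous g -> open [set x | f x <> g x].
Proof.
move=> cf cg; rewrite openE => x /= /eqP fg.
move: T_hausdorff; rewrite open_hausdorff => /(_ _ _ fg)[[A B] /=].
rewrite !inE => -[Ax By] [oA oB AB0].
have nA : nbhs x (f @^-1` A) by apply: cf; exact: open_nbhs_nbhs.
have nB : nbhs x (g @^-1` B) by apply: cg; exact: open_nbhs_nbhs.
apply: filterS (filterI nA nB) => y [/= Ay By'] fgy.
have : (A `&` B) (f y) by split => //; rewrite fgy.
by rewrite AB0.
Qed.

(** Finite sets are closed in a Hausdorff space, so removing the trace leaves an open set that
    misses [D]; by density it is empty. *)
Lemma open_finite_trace_sub (W : set T) :
  open W -> finite_set (W `&` D) -> W `<=` D.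
Proof.
move=> oW fWD x Wx; apply: contrapT => nDx.
have [y [[Wy nWDy] Dy]] : (W `\` (W `&` D)) `&` D !=set0.
  apply: D_dense; first by exists x; split => // -[].
  by rewrite setDE; apply: openI => //; exact/closed_openC/(finite_set_closed _ fWD).
exact: nWDy.
Qed.

Lemma open_finite_trace_point (W : set T) (p : T) :
  open W -> finite_set (W `&` D) -> W p -> open [set p].
Proof.
move=> oW fWD Wp.
have -> : [set p] = W `\` ((W `&` D) `\` [set p]).
  apply/seteqP; split => [_ ->|x [Wx nWx]]; first by split => // -[_]; apply.
  apply: contrapT => xp; apply: nWx; split; last by [].
  by split; last exact: (open_finite_trace_sub _ oW fWD).
rewrite setDE; apply: openI => //; apply: closed_openC.
exact: (finite_set_closed _ (finite_setD _ fWD)).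
Qed.

End DenseTrace.

(** This is [beta^i alpha^k], the normal form in the bicyclic monoid; [shift 0 0] is the identity
    and [shift 1 1] the idempotent [epsilon]. *)
Definition shift (i k : nat) : partial_map :=
  fun x => if (i < val x)%N then insub (val x + k - i)%N else None.

Lemma shiftE i k (x y : posnat) :
  shift i k x = Some y <-> (i < val x)%N /\ (val x + k = val y + i)%N.
Proof.
rewrite /shift; case: ifP => ix; last by split=> // -[]; plia.
case: insubP => [u _ uE|]; last by plia.
split=> [[<-]|[_ E]]; first by plia.
by congr Some; apply: val_inj; rewrite uE; plia.
Qed.

Lemma shift0 (x : posnat) : shift 0 0 x = Some x.
Proof. by apply/shiftE; split; first exact: valP. Qed.

Lemma shift_dom i k (x : posnat) : dom (shift i k) x <-> (i < val x)%N.
Proof.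
rewrite /dom /shift /=; case: ifP => // ix.
by case: insubP => [u _ uE|]; plia.
Qed.

Lemma shift_IN_infty i k : IN_infty (shift i k).
Proof.
split; last split.
- by move=> x y x' y' /shiftE[_ xE] /shiftE[_ yE]; plia.
- by apply/cofiniteP; exists i => x /shift_dom.
- apply/cofiniteP; exists k => y ky.
  have x0 : (0 < val y + i - k)%N by plia.
  by exists (exist (fun n => (0 < n)%N) _ x0); apply/shiftE; plia.
Qed.

Lemma shift_IN_g j i k : IN_g_set j (shift i k).
Proof.
have Is := shift_IN_infty i k; split => //.
have [dm mmin] := minimumP (IN_infty_dom Is).
have [_ smin] := minimumP (IN_infty_shift Is).
suff : (val (min_shift (shift i k)) <= val (min_dom (shift i k)))%N by plia.
apply: smin; split => //; apply/(restrict_C_N Is dm) => x mx.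
by apply/shift_dom; move/shift_dom: dm => dm; exact: leq_trans dm mx.
Qed.

Definition shift_g j i k : IN_g j := SigSub (mem_set (@shift_IN_g j i k)).

Lemma val_mulg j (g h : IN_g j) : val (g * h)%g = pcompose (val g) (val h).
Proof. by []. Qed.

Lemma IN_infty_val {j} (g : IN_g j) : IN_infty (val g).
Proof. by have [] := set_valP g. Qed.

Lemma IN_infty_inj {g : partial_map} {x y z : posnat} :
  IN_infty g -> g x = Some z -> g y = Some z -> x = y.
Proof.
move=> /isometry_translation[a [b E]] /E xE /E yE.
by apply: val_inj; move: xE yE; plia.
Qed.

(** Elements of [IN_infty] are translations on their domains, so one common value fixes the offset
    and only the domains remain to be compared. *)
Lemma IN_infty_ext {g h : partial_map} {z y : posnat} :
  IN_infty g -> IN_infty h -> g z = Some y -> h z = Some y ->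
  (forall x, isSome (g x) = isSome (h x)) -> g = h.
Proof.
move=> /isometry_translation[a [b gE]] /isometry_translation[c [d hE]] gz hz gh.
apply/funext => x; move: (gh x).
case gx: (g x) => [u|]; case hx: (h x) => [v|] // _.
congr Some; apply: val_inj.
by move: (gE _ _ gx) (gE _ _ gz) (hE _ _ hx) (hE _ _ hz); plia.
Qed.

(** The value at [z] fixes the translation, so [g] is determined by which of the points 1, ..., [N]
    lie in its domain. *)
Lemma finite_prescribed j (N : nat) (z y : posnat) :
  finite_set [set g : IN_g j |
    (forall x, (N < val x)%N -> dom (val g) x) /\ val g z = Some y].
Proof.
set A := [set g | _].
pose f (g : IN_g j) : {ffun 'I_N -> bool} :=
  [ffun i : 'I_N => isSome (val g (exist (fun n => (0 < n)%N) i.+1 isT))].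
have finj : {in A &, injective f}.
  move=> g h; rewrite !inE => -[dg gz] [dh hz] /ffunP fgh.
  apply: val_inj; apply: (IN_infty_ext _ _ gz hz);
    do 1?exact: IN_infty_val.
  move=> x; case: (ltnP N (val x)) => xN.
    by have := dg x xN; have := dh x xN; rewrite /dom /= => -> ->.
  have x0 : (0 < val x)%N := valP x.
  have xN' : ((val x).-1 < N)%N by plia.
  have := fgh (Ordinal xN'); rewrite !ffunE.
  suff -> : exist (fun n => (0 < n)%N) (Ordinal xN').+1 isT = x by [].
  by apply: val_inj => /=; rewrite prednK.
rewrite -(eq_finite_set (inj_card_eq finj)).
exact: finite_finset.
Qed.

(** A point [s] of [dom c] forces [x] to send [z = s a] to the only point [y] that [b] maps to
    [s c]; cofiniteness of [dom c] and [ran a] forces [x] to be defined far out. *)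
Lemma finite_solutions j (a b c : IN_g j) :
  finite_set [set x : IN_g j | (a * x * b)%g = c].
Proof.
have [aa [ab aE]] := isometry_translation (IN_infty_val a).
have [_ [/cofiniteP[N cN] _]] := IN_infty_val c.
have [_ [_ /cofiniteP[M aM]]] := IN_infty_val a.
pose s : posnat := exist (fun n => (0 < n)%N) N.+1 isT.
have := cN s (ltnSn N); rewrite /dom /=; case cs: (val c s) => [w|//] _.
have [[z [y [az yw]]]|no] :=
  pselect (exists z y, val a s = Some z /\ val b y = Some w); last first.
  apply: (@sub_finite_set _ _ set0) => // x /= xE; exfalso; apply: no.
  move: cs; rewrite -xE !val_mulg /pcompose /pcomp /=.
  case az: (val a s) => [z|//] /=; case xz: (val x z) => [y|//] /= yw.
  by exists z, y.
(* A point [u] beyond this bound is [v a] with [v = u + ab - aa > N], so [v] lies in the domain of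
   [c = a x b], and [u] in that of [x]. *)
apply: sub_finite_set (@finite_prescribed j (N + M + aa) z y) => x /= xE; split.
- move=> u uN; have [v au] := aM u ltac:(plia).
  have := aE _ _ au => auE.
  have := cN v ltac:(plia).
  rewrite -xE !val_mulg /dom /pcompose /pcomp /= au /=.
  by case: (val x u).
- move: cs; rewrite -xE !val_mulg /pcompose /pcomp /= az /=.
  case xz: (val x z) => [y'|//] /= yw'.
  by rewrite (IN_infty_inj (IN_infty_val b) yw' yw).
Qed.

Definition one_pos : posnat := exist (fun n => (0 < n)%N) 1%N isT.

Lemma finite_moved_by_epsilon j :
  finite_set [set x : IN_g j | (x * shift_g j 1 1)%g <> x /\
                               (shift_g j 1 1 * x)%g <> x].
Proof.
have epsE (y : posnat) : y <> one_pos -> shift 1 1 y = Some y.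
  move=> y1; apply/shiftE; split => //.
  have y0 : (0 < val y)%N := valP y.
  rewrite ltn_neqAle y0 andbT; apply/eqP => E; apply: y1; exact: val_inj.
apply: sub_finite_set (@finite_prescribed j j.+1 one_pos one_pos) => x /= -[xe ex].
have [a [b xE]] := isometry_translation (IN_infty_val x).
have [z xz] : exists z, val x z = Some one_pos.
  apply: contrapT => no; apply: xe; apply: val_inj; apply/funext => u.
  rewrite val_mulg /pcompose /pcomp /=; case xu: (val x u) => [v|//] /=.
  by apply: epsE => v1; apply: no; exists u; rewrite xu v1.
have [y xy] : exists y, val x one_pos = Some y.
  apply: contrapT => no; apply: ex; apply: val_inj; apply/funext => u.
  rewrite val_mulg /pcompose /pcomp /=.
  have [->|u1] := pselect (u = one_pos); last by rewrite epsE.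
  case xu: (val x one_pos) => [v|]; first by exfalso; apply: no; exists v.
  by rewrite /shift.
(* One and the same translation takes [z] down to 1 and 1 up to [y], so both displacements
   vanish. *)
have y1 : y = one_pos.
  apply: val_inj; move: (xE _ _ xz) (xE _ _ xy) (valP z) (valP y); plia.
split; last by rewrite xy y1.
move=> u uj; have Ix := IN_infty_val x.
have [_] := set_valP x; rewrite /min_shift /min_dom.
have [[dn Cn] _] := minimumP (IN_infty_shift Ix).
have [_ mmin] := minimumP (IN_infty_dom Ix).
have m1 : (val (minimum (dom (val x))) <= 1)%N.
  by apply: (mmin one_pos); rewrite /dom /= xy.
move: Cn => /(restrict_C_N Ix dn) nd nj.
by apply: nd; plia.
Qed.

Lemma IN_g_shift_inverse j (g : IN_g j) :
  exists n m, (shift_g j 0 n * g * shift_g j m 0)%g = shift_g j 0 0.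
Proof.
have [a [b gE]] := isometry_translation (IN_infty_val g).
have [_ [/cofiniteP[N gN] _]] := IN_infty_val g.
(* The first shift carries every point beyond [N], into [dom g]; there [g] adds [a - b], and
   subtracting [N + a] brings the point back. *)
exists (N + b)%N, (N + a)%N; apply: val_inj; apply/funext => x.
have x0 : (0 < val x)%N := valP x.
have u0 : (0 < val x + (N + b))%N by plia.
pose u : posnat := exist (fun n => (0 < n)%N) _ u0.
rewrite !val_mulg /pcompose /pcomp /=.
have -> : shift 0 (N + b) x = Some u by apply/shiftE; split => //=; lia.
rewrite /=; have := gN u ltac:(plia); rewrite /dom /=.
case gu: (val g u) => [v|//] _ /=.
have := gE _ _ gu => guE.
rewrite shift0.
by apply/shiftE; move: guE; plia.
Qed.

Theorem proposition3p3 (j : nat) (j_gt0 : (0 < j)%N)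
    (S : semitopologicalSemigroupType) (S_hausdorff : hausdorff_space S)
    (e : {multiplicative IN_g j -> S}) (e_inj : injective e)
    (e_proper : range e <> [set: S]) (e_dense : dense (range e)) :
  closed (~` range e) /\ ideal (~` range e).
Proof.
have trace_finite (W : set S) : finite_set (e @^-1` W) ->
    finite_set (W `&` range e).
  move=> fW; apply: sub_finite_set (finite_image e fW) => t [Wt [x _ xt]].
  by exists x => //=; rewrite xt.
have e_one_open : open [set e (shift_g j 0 0)].
  pose eps := e (shift_g j 1 1).
  apply: (@open_finite_trace_point _ _ S_hausdorff e_dense
    ([set x | (x * eps)%g <> x] `&` [set x | (eps * x)%g <> x])).
  - by apply: openI; apply: open_neq => // x;
      [exact: mulg_continuousr|exact: cvg_id|exact: mulg_continuousl|
       exact: cvg_id].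
  - apply: trace_finite; apply: sub_finite_set (finite_moved_by_epsilon j).
    by move=> x [/= xe ex]; split => E; [apply: xe|apply: ex];
      rewrite -gmulfM E.
  (* The identity is moved by both translations because it is defined at 1 and [epsilon] is not. *)
  - by split => /=; rewrite -gmulfM => /e_inj /(congr1 val)
      /(congr1 (fun f : partial_map => f one_pos));
      rewrite val_mulg /pcompose /pcomp /= shift0.
have e_open g : open [set e g].
  have [n [m gE]] := IN_g_shift_inverse j g.
  set a := shift_g _ _ _ in gE; set b := shift_g _ _ _ in gE.
  apply: (@open_finite_trace_point _ _ S_hausdorff e_dense
    ((fun x => e a * x)%g @^-1` ((fun x => x * e b)%g
      @^-1` [set e (shift_g j 0 0)]))).
  - apply: open_comp; first by move=> x _; exact: mulg_continuousl.
    by apply: open_comp => // x _; exact: mulg_continuousr.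
  - apply: trace_finite.
    apply: sub_finite_set (finite_solutions j a b (shift_g j 0 0)) => x /=.
    by rewrite -!gmulfM => /e_inj.
  - by rewrite /= -!gmulfM gE.
have range_open : open (range e).
  rewrite openE => _ [g _ <-].
  have : nbhs (e g) [set e g] by exact: open_nbhs_nbhs.
  by apply: filterS => _ ->; exists g.
have mulr_range s g h : (s * e g)%g = e h -> range e s.
  move=> sE; apply: (@open_finite_trace_sub _ _ S_hausdorff e_dense
    ((fun x => x * e g)%g @^-1` [set e h])) => //.
    by apply: open_comp => // x _; exact: mulg_continuousr.
  (* Multiplying [x g = h] on the left by the identity gives it the two-sided form of
     [finite_solutions]. *)
  apply: trace_finite; apply: sub_finite_set
    (finite_solutions j (shift_g j 0 0) g (shift_g j 0 0 * h)%g) => x /=.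
  by rewrite -!gmulfM -mulgA => /e_inj ->.
have mull_range s g h : (e g * s)%g = e h -> range e s.
  move=> sE; apply: (@open_finite_trace_sub _ _ S_hausdorff e_dense
    ((fun x => e g * x)%g @^-1` [set e h])) => //.
    by apply: open_comp => // x _; exact: mulg_continuousl.
  apply: trace_finite; apply: sub_finite_set
    (finite_solutions j g (shift_g j 0 0) (h * shift_g j 0 0)%g) => x /=.
  by rewrite -!gmulfM => /e_inj ->.
split; first exact: open_closedC.
split.
  apply: contrapT => no; apply: e_proper; apply/seteqP; split => // s _.
  by apply: contrapT => ns; apply: no; exists s.
move=> s x Ix; split => -[h _ hE]; apply: Ix.
(* The solutions [y] of [y x = h] form an open set containing [s], so by density one of them is some
   [g] of the dense copy, and [mull_range] applies to [g x = h]. *)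
- have [t [xt [g _ gE]]] :
      ((fun y => y * x)%g @^-1` [set e h]) `&` range e !=set0.
    apply: e_dense; first by exists s.
    by apply: open_comp => // y _; exact: mulg_continuousr.
  by apply: (mull_range _ g h); rewrite gE.
- have [t [xt [g _ gE]]] :
      ((fun y => x * y)%g @^-1` [set e h]) `&` range e !=set0.
    apply: e_dense; first by exists s.
    by apply: open_comp => // y _; exact: mulg_continuousl.
  by apply: (mulr_range _ g h); rewrite gE.
Qed.
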